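(* Let $\mathbb{F}\in\{\mathbb{R},\mathbb{C},\mathbb{H}\}$ and let $A\in\mathbb{F}_d[z,z^{-1}]$ be a matrix Laurent polynomial which, regarded as a complex matrix Laurent polynomial, satisfies $\det A(z)\neq 0$ for all $|z|=1$. Let $\mathcal{K}=\{\kappa_1\ge\dots\ge\kappa_d\}$ be its set of symmetric partial indices. Then there exists a factorization $A=A_+DA_-$ such that $A_+\in\mathbb{F}_d[z]$ is invertible for all $|z|\le 1$, $A_-\in\mathbb{F}_d[z^{-1}]$ is invertible for all $|z^{-1}|\le 1$, and $$D(z,z^{-1})=\sum_{m=1}^d z^{\kappa_m}\,|m\rangle\langle m|\,\mathbf{1}_{\mathbb{F}} .$$
   Context: $\mathbb{F}_d$ denotes $d\times d$ matrices with entries in $\mathbb{F}$, and $\mathbb{F}_d[z,z^{-1}]$ (resp. $\mathbb{F}_d[z]$, $\mathbb{F}_d[z^{-1}]$) denotes matrix Laurent polynomials $\sum_{r=p}^q a_r z^r$ with $a_r\in\mathbb{F}_d$ (resp. with only $r\ge0$, only $r\le 0$). Quaternions are realized inside $2\times2$ complex matrices as real combinations of $\mathbf{1}_{\mathbb{H}}=I_2$, $\mathbf{i}=i\sigma_x$, $\mathbf{j}=i\sigma_y$, $\mathbf{k}=i\sigma_z$; thus $\mathbb{H}_d\subset\mathbb{C}_{2d}$ consists of complex $2d\times 2d$ matrices $Q$ with $(I_d\otimes\sigma_y)\overline{Q}(I_d\otimes\sigma_y)=Q$, and $|m\rangle\langle m|\mathbf{1}_{\mathbb{F}}$ denotes the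 matrix unit at position $(m,m)$ (a $2\times2$ identity block when $\mathbb{F}=\mathbb{H}$). A (standard) Wiener–Hopf (WH) factorization of a complex matrix Laurent polynomial $A$ invertible on the unit circle is $A=A_+DA_-$ with $A_+$ a polynomial in $z$ invertible for $|z|\le1$, $A_-$ a polynomial in $z^{-1}$ invertible for $|z^{-1}|\le1$, and $D=\mathrm{diag}(z^{\kappa_1},\dots,z^{\kappa_n})$ with integers $\kappa_1\ge\dots\ge\kappa_n$; such a factorization exists and the integers (partial indices) are uniquely determined by $A$. Symmetric partial indices: for $\mathbb{F}=\mathbb{R},\mathbb{C}$, $\mathcal{K}$ is the list of standard partial indices of $A$; for $\mathbb{F}=\mathbb{H}$, the $2d$ standard partial indices of $A$ viewed in $\mathbb{C}_{2d}$ occur in equal pairs, and $\mathcal{K}$ is the list of $d$ integers obtained by keeping one from each pair, ordered $\kappa_1\ge\dots\ge\kappa_d$. *)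

(* Defs.v *)
From HB Require Import structures.
From mathcomp Require Import all_boot all_order all_algebra.
From mathcomp Require Import complex mxtens.
From mathcomp Require Import reals.
Set Implicit Arguments. Unset Strict Implicit. Unset Printing Implicit Defensive.
Import Order.TTheory GRing.Theory Num.Theory.
Local Open Scope ring_scope.

Record mlpoly (R : realType) (n : nat) := MLPoly {
  mlc : int -> 'M[R[i]]_n ;
  mldeg : nat ;
  mlc_supp : forall r : int, (mldeg < `|r|)%N -> mlc r = 0 }.

(* evaluation at z (z <> 0 for genuine Laurent polynomials) *)
Definition meval (R : realType) n (A : mlpoly R n) (z : R[i]) : 'M[R[i]]_n :=
  \sum_(k < (mldeg A).*2.+1) (z ^ (k%:Z - (mldeg A)%:Z)) *: mlc A (k%:Z - (mldeg A)%:Z).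

Definition in_polz (R : realType) n (A : mlpoly R n) : Prop :=
  forall r : int, r < 0 -> mlc A r = 0.

Definition in_polzinv (R : realType) n (A : mlpoly R n) : Prop :=
  forall r : int, 0 < r -> mlc A r = 0.

(* For A in F_n[z^{-1}], its value as a polynomial in w = z^{-1}:
   \sum_{r <= 0} c_r w^{-r}  (well defined also at w = 0, i.e. z = oo). *)
Definition meval_inv (R : realType) n (A : mlpoly R n) (w : R[i]) : 'M[R[i]]_n :=
  \sum_(k < (mldeg A).+1) (w ^+ k) *: mlc A (- (k%:Z)).

Inductive numsys := FR | FC | FH.

Definition cdim (F : numsys) (d : nat) : nat :=
  match F with FH => (d * 2)%N | _ => d end.

Definition sigma_y (R : realType) : 'M[R[i]]_2 :=
  \matrix_(a < 2, b < 2)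
    (if ((a : nat) == 0%N) && ((b : nat) == 1%N) then - 'i
     else if ((a : nat) == 1%N) && ((b : nat) == 0%N) then 'i else 0).

(* the complex matrix Q of size cdim F d represents an element of F_d :
   R: real entries; C: anything;
   H: (I_d (x) sigma_y) conj(Q) (I_d (x) sigma_y) = Q. *)
Definition inF (R : realType) (F : numsys) (d : nat) : 'M[R[i]]_(cdim F d) -> Prop :=
  match F return 'M[R[i]]_(cdim F d) -> Prop with
  | FR => fun Q => forall i j, conjc (Q i j) = Q i j
  | FC => fun _ => True
  | FH => fun Q =>
      let J := (1%:M : 'M[R[i]]_d) *t sigma_y R in
      J *m map_mx (@conjc R) Q *m J = Q
  end.

Definition mlpoly_inF (R : realType) (F : numsys) (d : nat)
  (A : mlpoly R (cdim F d)) : Prop := forall r, inF (mlc A r).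

Definition diag_pows (R : realType) n (k : seq int) (z : R[i]) : 'M[R[i]]_n :=
  \matrix_(a < n, b < n) (if a == b then z ^ (nth 0 k a) else 0).

(* A = A_+ D A_- as Laurent polynomials, i.e. as functions on z <> 0 *)
Definition WH_factorization (R : realType) n (A Ap Am : mlpoly R n)
  (D : R[i] -> 'M[R[i]]_n) : Prop :=
  [/\ in_polz Ap, forall z : R[i], `|z| <= 1 -> meval Ap z \in unitmx,
      in_polzinv Am, forall w : R[i], `|w| <= 1 -> meval_inv Am w \in unitmx
    & forall z : R[i], z != 0 -> meval A z = meval Ap z *m D z *m meval Am z].

Definition partial_indices (R : realType) n (A : mlpoly R n) (k : seq int) : Prop :=
  [/\ size k = n, sorted (fun x y : int => y <= x) k
    & exists Ap Am : mlpoly R n, WH_factorization A Ap Am (diag_pows n k)].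

Definition numsys_mult (F : numsys) : nat := match F with FH => 2%N | _ => 1%N end.

Definition sym_partial_indices (R : realType) (F : numsys) (d : nat)
  (A : mlpoly R (cdim F d)) (K : seq int) : Prop :=
  [/\ size K = d, sorted (fun x y : int => y <= x) K &
      partial_indices A (flatten [seq nseq (numsys_mult F) x | x <- K])].

(* D(z) = \sum_m z^{kappa_m} |m><m| 1_F, as a cdim F d complex matrix *)
Definition Dsym (R : realType) (F : numsys) (d : nat) (K : seq int) (z : R[i])
  : 'M[R[i]]_(cdim F d) :=
  \matrix_(a, b) (if a == b then z ^ (nth 0 K (a %/ numsys_mult F)) else 0).

(* Main.v *)
Require Import Defs.
From HB Require Import structures.
From mathcomp Require Import all_boot all_order all_algebra.
From mathcomp Require Import complex mxtens.
From mathcomp Require Import reals.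
From mathcomp Require Import ring.
Import Order.TTheory GRing.Theory Num.Theory.
Local Open Scope ring_scope.

Set Implicit Arguments.
Unset Strict Implicit.
Unset Printing Implicit Defensive.

(** All three cases share one mechanism. Let [X^star = S conj(X) S] be the
    antilinear multiplicative involution whose fixed points are the matrices over
    [F] ([S = 1] for the reals, [S = 1 (x) sigma_y] for the quaternions). If
    [A = P D Q] is a complex factorization of a [star]-invariant [A], then
    [A = P^star D Q^star] is another one, so [U := P^-1 P^star] satisfies
    [U D = D V] with [V := Q (Q^star)^-1]. By a Liouville argument [U] is a
    polynomial in [z] and [V] one in [1/z]. For a constant [c],
    [c P + c^* P^star = P (c + c^* U)] is [star]-invariant, and
    [det (c + c^* U) = det (c + c^* V)] is constant because it is polynomial both in
    [z] and in [1/z]; it is nonzero for a suitable [c]. *)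

(** * Scalar identities between polynomials in [z] and in [1/z] *)

Section ScalarLaurent.
Variable C : numClosedFieldType.
Implicit Types p q r s : {poly C}.

(** Positive integers serve as test points throughout: they are nonzero, fixed by conjugation, and
    their inverses lie in the closed unit disc. *)
Lemma poly_neq0_pos_nat p : p != 0 -> exists n : nat, p.[n.+1%:R] != 0.
Proof.
move=> p0; pose rs := [seq n.+1%:R : C | n <- iota 0 (size p)].
have urs : uniq rs.
  rewrite map_inj_uniq ?iota_uniq // => m n /eqP.
  by rewrite eqr_nat eqSS => /eqP.
have /allPn[_ /mapP[n _ ->] nr] : ~~ all (root p) rs.
  apply/negP => ars; have := max_poly_roots p0 ars urs.
  by rewrite size_map size_iota ltnn.
by exists n.
Qed.

Lemma poly_eq_on_pos_nat p q :
  (forall n : nat, p.[n.+1%:R] = q.[n.+1%:R]) -> p = q.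
Proof.
move=> pq; apply/eqP; rewrite -subr_eq0; apply/negP => /negP.
by case/poly_neq0_pos_nat => n; rewrite !hornerE pq subrr eqxx.
Qed.

Lemma poly_eq_off0 p q : (forall z, z != 0 -> p.[z] = q.[z]) -> p = q.
Proof. by move=> pq; apply: poly_eq_on_pos_nat => n; rewrite pq ?pnatr_eq0. Qed.

(** Clears the powers of [1/z], so that Laurent identities become polynomial ones; the size bound
    feeds the degree count in [laurent_two_sided_const]. *)
Lemma poly_reverse p : exists p' : {poly C}, exists2 N : nat,
  (size p' <= N.+1)%N & forall z, z != 0 -> p'.[z] = z ^+ N * p.[z^-1].
Proof.
elim/poly_ind: p => [|p c [p' [N sz e]]].
  by exists 0, 0%N => [|z _]; rewrite ?size_poly0 // !horner0 mulr0.
exists (p' + c *: 'X^(N.+1)), N.+1 => [|z z0].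
  rewrite (leq_trans (size_polyD _ _)) // geq_max (leq_trans sz) //=.
  by rewrite (leq_trans (size_scale_leq _ _)) // size_polyXn.
rewrite !hornerE e // exprS; set x := p.[_].
by field.
Qed.

Lemma int_exp_split (m : int) : exists a b : nat,
  forall z : C, z != 0 -> z ^ m * z ^+ a = z ^+ b.
Proof.
case: m => n; first by exists 0%N, n => z _; rewrite mulr1.
by exists n.+1, 0%N => z z0; rewrite NegzE mulVf ?expf_neq0.
Qed.

(* Both sides of [p / q = z^m (r / s)(1/z)] are holomorphic on one side of the
   unit circle, so [p / q] is polynomial; algebraically, [q] is coprime to the
   reversal of [s], whose roots lie in the open disc. *)
Lemma dvdp_of_laurent_identity p q r s (m : int) :
  (forall z, `|z| <= 1 -> q.[z] != 0) -> (forall w, `|w| <= 1 -> s.[w] != 0) ->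
  (forall z, z != 0 -> p.[z] * s.[z^-1] = z ^ m * r.[z^-1] * q.[z]) ->
  q %| p.
Proof.
move=> hq hs e.
have [s' [N _ es]] := poly_reverse s; have [r' [M _ er]] := poly_reverse r.
have [a [b eab]] := int_exp_split m.
have eP : p * (s' * 'X^(a + M)) = (r' * 'X^(b + N)) * q.
  apply: poly_eq_off0 => z z0; rewrite !(hornerM, hornerXn) es // er //.
  rewrite !exprD -(eab z z0).
  have := e z z0; set x := p.[z]; set y := s.[_]; set t := r.[_].
  set u := q.[z] => h.
  transitivity ((x * y) * (z ^+ N * z ^+ a * z ^+ M)); first by ring.
  by rewrite h; ring.
have co : coprimep q (s' * 'X^(a + M)).
  apply/Pdiv.ClosedField.coprimepP => z rz.
  have z1 : 1 < `|z|.
    by rewrite real_ltNge ?real1 ?normr_real //; apply: contraL rz => /hq.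
  have z0 : z != 0 by rewrite -normr_gt0 (lt_trans ltr01).
  rewrite !(hornerM, hornerXn) es // !mulf_neq0 ?expf_neq0 // hs // normfV.
  by rewrite invf_le1 ?ltW // (lt_trans ltr01).
by rewrite -(Gauss_dvdpl _ co) eP dvdp_mull.
Qed.

(** Replacing [z] by [1/z] exchanges the pairs [(p, q)] and [(r, s)] and keeps the exponent [m], so
    the divisibility lemma applies on both sides; cancelling [q] and [s] then relates the
    quotients. *)
Lemma laurent_identity_quotients p q r s (m : int) :
  (forall z, `|z| <= 1 -> q.[z] != 0) -> (forall w, `|w| <= 1 -> s.[w] != 0) ->
  (forall z, z != 0 -> p.[z] * s.[z^-1] = z ^ m * r.[z^-1] * q.[z]) ->
  exists u, exists v, [/\ p = u * q, r = v * s
    & forall z, z != 0 -> u.[z] = z ^ m * v.[z^-1]].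
Proof.
move=> hq hs e.
have /dvdpP[u pu] := dvdp_of_laurent_identity hq hs e.
have e' z : z != 0 -> r.[z] * q.[z^-1] = z ^ m * p.[z^-1] * s.[z].
  move=> z0; have := e z^-1; rewrite invr_eq0 invrK => /(_ z0) h.
  by rewrite -mulrA h !mulrA -expfzMl mulfV // exp1rz mul1r.
have /dvdpP[v rv] := dvdp_of_laurent_identity hs hq e'.
exists u, v; split=> //.
have [s' [N _ es]] := poly_reverse s; have [v' [M _ ev]] := poly_reverse v.
have [a [b eab]] := int_exp_split m.
have q0 : q != 0.
  by apply/eqP => q0; have := hq 0; rewrite q0 horner0 normr0 ler01 eqxx => /(_ isT).
have s0 : s' != 0.
  apply/eqP => q0'; have := hs 1; have := es 1.
  rewrite q0' horner0 invr1 expr1n mul1r oner_eq0 => /(_ isT) <-.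
  by rewrite normr1 lexx eqxx => /(_ isT).
have : u * 'X^(a + M) = v' * 'X^b.
  apply: (mulIf s0); apply: (mulIf q0); apply: poly_eq_off0 => z z0.
  have := e z z0; rewrite pu rv !(hornerM, hornerXn) es // ev // exprD -(eab z z0).
  set x := u.[z]; set y := s.[_]; set t := v.[_]; set w := q.[z] => h.
  transitivity ((x * w * y) * (z ^+ N * z ^+ a * z ^+ M)); first by ring.
  by rewrite h; ring.
move=> euv z z0; have := congr1 (fun p => p.[z]) euv.
rewrite !(hornerM, hornerXn) ev // exprD -(eab z z0) => h.
apply: (mulIf (expf_neq0 a z0)); apply: (mulIf (expf_neq0 M z0)).
by rewrite -mulrA h; ring.
Qed.

(** A Liouville theorem by degree count: [f * 'X^N] is the reversal of [g], of size at most [N.+1],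
    which forces [f] to be constant. *)
Lemma laurent_two_sided_const (f g : {poly C}) :
  (forall z, z != 0 -> f.[z] = g.[z^-1]) -> f = (g.[1])%:P /\ g = (g.[1])%:P.
Proof.
move=> fg; have [g' [N sz eg]] := poly_reverse g.
have fX : f * 'X^N = g'.
  by apply: poly_eq_off0 => z z0; rewrite hornerM hornerXn fg // eg // mulrC.
have sf : (size f <= 1)%N.
  have [->|f0] := eqVneq f 0; first by rewrite size_poly0.
  by move: sz; rewrite -fX size_mulXn // -[N.+1]addn1 leq_add2l.
have ef := size1_polyC sf.
have fz y : f.[y] = f`_0 by rewrite {1}ef hornerC.
have e1 : g.[1] = f`_0 by have := fg 1 (oner_neq0 _); rewrite invr1 fz.
rewrite e1; split=> //; apply: poly_eq_off0 => z z0.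
by have := fg z^-1; rewrite invrK invr_eq0 fz hornerC => /(_ z0) <-.
Qed.

End ScalarLaurent.

(** * Polynomial matrices, the star involution and the symmetrized factorization *)

Section Symmetrization.
Variables (C : numClosedFieldType) (n : nat).
Implicit Types (P Q U V : 'M[{poly C}]_n) (X Y : 'M[C]_n).

Definition mxeval P (z : C) : 'M[C]_n := map_mx (horner_eval z) P.

Lemma mxevalE P z i j : mxeval P z i j = (P i j).[z].
Proof. by rewrite mxE. Qed.

Lemma mxevalM P Q z : mxeval (P *m Q) z = mxeval P z *m mxeval Q z.
Proof. exact: map_mxM. Qed.

Lemma mxevalD P Q z : mxeval (P + Q) z = mxeval P z + mxeval Q z.
Proof. exact: map_mxD. Qed.

Lemma mxevalZ p P z : mxeval (p *: P) z = p.[z] *: mxeval P z.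
Proof. exact: map_mxZ. Qed.

Lemma mxeval_scalar p z : mxeval p%:M z = (p.[z])%:M.
Proof. exact: map_scalar_mx. Qed.

Lemma mxeval_polyC X z : mxeval (map_mx polyC X) z = X.
Proof. by apply/matrixP => i j; rewrite mxevalE mxE hornerC. Qed.

Lemma det_mxeval P z : \det (mxeval P z) = (\det P).[z].
Proof. exact: det_map_mx. Qed.

Lemma unitmx_mxeval P z : (mxeval P z \in unitmx) = ((\det P).[z] != 0).
Proof. by rewrite unitmxE det_mxeval unitfE. Qed.

Lemma scalepmxI (p : {poly C}) : p != 0 -> injective (fun P => p *: P).
Proof.
move=> p0 P Q /matrixP e; apply/matrixP => i j; apply: (mulfI p0).
by have := e i j; rewrite !mxE.
Qed.

Lemma exists_det_conj_pencil X :
  X \in unitmx -> exists c : C, \det (c%:M + c^* *: X) != 0.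
Proof.
rewrite unitmxE unitfE => X0.
(* For real [t] the number [c = 1 + 'i * t] has conjugate [1 - 'i * t], so the determinant sought is
   a polynomial in [t]. At [t = 'i] the pencil collapses to [2 X], hence this polynomial is
   nonzero. *)
pose M : 'M[{poly C}]_n := (1 + 'i *: 'X)%:M + (1 - 'i *: 'X) *: map_mx polyC X.
have eM z : mxeval M z = (1 + 'i * z)%:M + (1 - 'i * z) *: X.
  by rewrite mxevalD mxeval_scalar mxevalZ mxeval_polyC !hornerE.
have M0 : \det M != 0.
  apply: contraNneq X0 => M0; have := det_mxeval M 'i.
  rewrite M0 horner0 eM -expr2 sqrCi subrr opprK raddf0 add0r detZ => /eqP.
  by rewrite mulf_eq0 expf_eq0 -(natrD C 1 1) pnatr_eq0 andbF.
have [m hm] := poly_neq0_pos_nat M0.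
have cE : (1 + 'i * m.+1%:R : C)^* = 1 - 'i * m.+1%:R.
  by rewrite rmorphD rmorph1 rmorphM /= conjCi rmorph_nat mulNr.
by exists (1 + 'i * m.+1%:R); rewrite cE -eM det_mxeval.
Qed.

(** The sign [eps] covers both structures: it is 1 for the reals and -1 for the quaternions, because
    [sigma_y] has imaginary entries. It enters [mxstarK] twice and cancels. *)
Variables (S : 'M[C]_n) (eps : C) (k : 'I_n -> int).
Hypothesis S2 : S *m S = 1%:M.
Hypothesis eps2 : eps * eps = 1.
Hypothesis S_conj : map_mx Num.conj S = eps *: S.

Definition mxstar X := S *m map_mx Num.conj X *m S.

(** Only coefficients are conjugated, not the variable, so the result is again polynomial; its value
    at [z] is the star of the value at [z^*]. *)
Definition pmxstar P :=
  map_mx polyC S *m map_mx (map_poly Num.conj) P *m map_mx polyC S.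

Definition zdiag (z : C) : 'M[C]_n := diag_mx (\row_j z ^ k j).

Hypothesis S_zdiag : forall z, S *m zdiag z = zdiag z *m S.

Lemma mxstarM X Y : mxstar (X *m Y) = mxstar X *m mxstar Y.
Proof.
by rewrite /mxstar map_mxM !mulmxA -(mulmxA _ S S) S2 mulmx1.
Qed.

Lemma mxstarD X Y : mxstar (X + Y) = mxstar X + mxstar Y.
Proof. by rewrite /mxstar map_mxD mulmxDr mulmxDl. Qed.

Lemma mxstarZ c X : mxstar (c *: X) = c^* *: mxstar X.
Proof. by rewrite /mxstar map_mxZ -scalemxAr -scalemxAl. Qed.

Lemma mxstarK X : mxstar (mxstar X) = X.
Proof.
rewrite /mxstar !map_mxM S_conj -map_mx_comp map_mx_id => [|x /=]; last exact: conjCK.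
rewrite -!(scalemxAl, scalemxAr) scalerA eps2 scale1r !mulmxA S2 mul1mx.
by rewrite -mulmxA S2 mulmx1.
Qed.

Lemma mxstar_unit X : (mxstar X \in unitmx) = (X \in unitmx).
Proof.
have S0 : S \in unitmx by case/mulmx1_unit: S2.
by rewrite /mxstar !unitmx_mul S0 andbT /= map_unitmx.
Qed.

Lemma mxeval_pmxstar P z : mxeval (pmxstar P) z = mxstar (mxeval P z^*).
Proof.
rewrite /pmxstar !mxevalM mxeval_polyC; congr (_ *m _ *m _).
by apply/matrixP => i j; rewrite !mxE /= -{1}[z]conjCK /horner_eval horner_map.
Qed.

Lemma mxstar_zdiag z : mxstar (zdiag z^*) = zdiag z.
Proof.
have -> : mxstar (zdiag z^*) = S *m zdiag z *m S.
  congr (_ *m _ *m _); apply/matrixP => i j; rewrite !mxE rmorphMn /=.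
  by congr (_ *+ _); rewrite fmorphXz /= conjCK.
by rewrite S_zdiag -mulmxA S2 mulmx1.
Qed.

Lemma mxeval_inj P Q : (forall m : nat, mxeval P m.+1%:R = mxeval Q m.+1%:R) -> P = Q.
Proof.
move=> e; apply/matrixP => i j; apply: poly_eq_on_pos_nat => m.
by rewrite -!mxevalE e.
Qed.

Lemma pmxstarK P : pmxstar (pmxstar P) = P.
Proof. by apply: mxeval_inj => m; rewrite !mxeval_pmxstar mxstarK conjCK. Qed.

Lemma mul_zdiag_mx z X i j : (zdiag z *m X) i j = z ^ k i * X i j.
Proof. by rewrite /zdiag mul_diag_mx !mxE. Qed.

Lemma mul_mx_zdiag z X i j : (X *m zdiag z) i j = X i j * z ^ k j.
Proof. by rewrite /zdiag mul_mx_diag !mxE. Qed.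

Lemma zdiag_unit z : z != 0 -> zdiag z \in unitmx.
Proof.
move=> z0; rewrite unitmxE det_diag unitfE; apply/prodf_neq0 => i _.
by rewrite mxE expfz_neq0.
Qed.

(** Passes from invariance of a polynomial matrix to invariance of each coefficient, which is how
    membership in [F] is expressed. *)
Lemma pmxstarE P i : (map_mx (fun p : {poly C} => p`_i) (pmxstar P)) =
  mxstar (map_mx (fun p : {poly C} => p`_i) P).
Proof.
apply/matrixP => a b; rewrite !mxE coef_sum; apply: eq_bigr => j _.
rewrite !mxE coefMC coef_sum; congr (_ * _); apply: eq_bigr => l _.
by rewrite !mxE coefCM coef_map.
Qed.

(** Formally [U = P^-1 P1] and [V = Q Q1^-1]. By Cramer's rule their entries are fractions over
    [\det P] and [\det Q1], and entry [(i, j)] of [U D = D V] is the scalar identity of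
    [laurent_identity_quotients] with [m = k i - k j]. *)
Lemma intertwiner_exists P P1 Q Q1 :
  (forall z, `|z| <= 1 -> mxeval P z \in unitmx) ->
  (forall w, `|w| <= 1 -> mxeval Q1 w \in unitmx) ->
  (forall z, z != 0 -> mxeval P z *m zdiag z *m mxeval Q z^-1 =
     mxeval P1 z *m zdiag z *m mxeval Q1 z^-1) ->
  exists U, exists V, [/\ P *m U = P1, V *m Q1 = Q
    & forall z, z != 0 -> mxeval U z *m zdiag z = zdiag z *m mxeval V z^-1].
Proof.
move=> uP uQ1 e.
pose p := \adj P *m P1; pose r := Q *m \adj Q1.
have hq z : `|z| <= 1 -> (\det P).[z] != 0 by move/uP; rewrite unitmx_mxeval.
have hs z : `|z| <= 1 -> (\det Q1).[z] != 0 by move/uQ1; rewrite unitmx_mxeval.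
have hpr z : z != 0 -> (\det Q1).[z^-1] *: (mxeval p z *m zdiag z) =
    (\det P).[z] *: (zdiag z *m mxeval r z^-1).
  move=> z0; have := congr1 (fun X => mxeval (\adj P) z *m X *m mxeval (\adj Q1) z^-1) (e z z0).
  rewrite /p /r !mxevalM !mulmxA -mxevalM mul_adj_mx mxeval_scalar => h.
  rewrite -[RHS]mul_scalar_mx !mulmxA h -!mulmxA.
  by rewrite -mxevalM mul_mx_adj mxeval_scalar mul_mx_scalar -!scalemxAr.
have q0 : \det P != 0.
  by apply/eqP => q0; have := hq 0; rewrite q0 horner0 normr0 ler01 eqxx => /(_ isT).
have s0 : \det Q1 != 0.
  by apply/eqP => s0; have := hs 0; rewrite s0 horner0 normr0 ler01 eqxx => /(_ isT).
(* These Euclidean quotients turn out to be exact, as [UV] shows. *)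
pose U : 'M[{poly C}]_n := \matrix_(i, j) (p i j %/ \det P).
pose V : 'M[{poly C}]_n := \matrix_(i, j) (r i j %/ \det Q1).
have UV i j : [/\ p i j = U i j * \det P, r i j = V i j * \det Q1
    & forall z, z != 0 -> (U i j).[z] = z ^ (k i - k j) * (V i j).[z^-1]].
  have e2 z : z != 0 ->
      (p i j).[z] * (\det Q1).[z^-1] = z ^ (k i - k j) * (r i j).[z^-1] * (\det P).[z].
    move=> z0; have /matrixP/(_ i j) := hpr z z0.
    rewrite [LHS]mxE [RHS]mxE mul_mx_zdiag mul_zdiag_mx !mxevalE.
    rewrite expfzDr // -invr_expz => h.
    apply: (mulIf (expfz_neq0 (k j) z0)).
    rewrite mulrAC mulrC h; have := expfz_neq0 (k j) z0.
    by set a := z ^ k j; set b := z ^ k i => a0; field.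
  have [u [v [pu rv uv]]] := laurent_identity_quotients hq hs e2.
  by rewrite [U i j]mxE [V i j]mxE pu rv !mulpK.
exists U, V; split.
- have qU : \det P *: U = p.
    by apply/matrixP => i j; have [-> _ _] := UV i j; rewrite [LHS]mxE mulrC.
  apply: (scalepmxI q0); rewrite scalemxAr qU /p mulmxA mul_mx_adj.
  by rewrite mul_scalar_mx.
- have sV : \det Q1 *: V = r.
    by apply/matrixP => i j; have [_ -> _] := UV i j; rewrite [LHS]mxE mulrC.
  apply: (scalepmxI s0); rewrite scalemxAl sV /r -mulmxA mul_adj_mx.
  by rewrite mul_mx_scalar.
- move=> z z0; apply/matrixP => i j.
  rewrite mul_mx_zdiag mul_zdiag_mx !mxevalE; have [_ _ ->] := UV i j; last by [].
  rewrite expfzDr // -invr_expz; have := expfz_neq0 (k j) z0.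
  by set a := z ^ k j; set b := z ^ k i => a0; field.
Qed.

Theorem star_invariant_factorization (A : C -> 'M[C]_n) P Q :
  (forall z, z != 0 -> mxstar (A z^*) = A z) ->
  (forall z, `|z| <= 1 -> mxeval P z \in unitmx) ->
  (forall w, `|w| <= 1 -> mxeval Q w \in unitmx) ->
  (forall z, z != 0 -> A z = mxeval P z *m zdiag z *m mxeval Q z^-1) ->
  exists P', exists Q', [/\ pmxstar P' = P', pmxstar Q' = Q',
    forall z, `|z| <= 1 -> mxeval P' z \in unitmx,
    forall w, `|w| <= 1 -> mxeval Q' w \in unitmx
    & forall z, z != 0 -> A z = mxeval P' z *m zdiag z *m mxeval Q' z^-1].
Proof.
move=> starA uP uQ eA.
have uP1 z : `|z| <= 1 -> mxeval (pmxstar P) z \in unitmx.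
  by move=> z1; rewrite mxeval_pmxstar mxstar_unit uP // norm_conjC.
have uQ1 z : `|z| <= 1 -> mxeval (pmxstar Q) z \in unitmx.
  by move=> z1; rewrite mxeval_pmxstar mxstar_unit uQ // norm_conjC.
(* The second factorization is the star of the first, with the same middle factor. *)
have [z z0|U [V [PU VQ UD]]] := @intertwiner_exists P (pmxstar P) Q (pmxstar Q) uP uQ1.
  rewrite -eA // -starA // eA ?conjC_eq0 // !mxstarM mxstar_zdiag.
  by rewrite !mxeval_pmxstar -fmorphV.
have n1 : `|1 : C| <= 1 by rewrite normr1.
have U1 : mxeval U 1 \in unitmx.
  by have := uP1 1 n1; rewrite -PU mxevalM unitmx_mul => /andP[].
(* Nonvanishing at the single point 1 suffices, since [\det W] will be constant. *)
have [c c0] := exists_det_conj_pencil U1.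
pose W : 'M[{poly C}]_n := c%:P%:M + c^*%:P *: U.
pose X : 'M[{poly C}]_n := c%:P%:M + c^*%:P *: V.
have WE z : mxeval W z = c%:M + c^* *: mxeval U z.
  by rewrite mxevalD mxeval_scalar mxevalZ !hornerC.
have XE z : mxeval X z = c%:M + c^* *: mxeval V z.
  by rewrite mxevalD mxeval_scalar mxevalZ !hornerC.
have WD z : z != 0 -> mxeval W z *m zdiag z = zdiag z *m mxeval X z^-1.
  move=> z0; rewrite WE XE mulmxDl mulmxDr -scalemxAl UD // -scalemxAr.
  by rewrite mul_scalar_mx mul_mx_scalar.
(* Taking determinants in [WD] cancels that of [zdiag z]; a polynomial in [z] then equals one in
   [1/z]. *)
have detWX z : z != 0 -> (\det W).[z] = (\det X).[z^-1].
  move=> z0; rewrite -!det_mxeval.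
  have D0 : \det (zdiag z) != 0 by rewrite -unitfE -unitmxE zdiag_unit.
  by apply: (mulIf D0); rewrite [RHS]mulrC -!det_mulmx WD.
have [] := laurent_two_sided_const detWX; set delta := (\det X).[1] => dW dX.
have delta0 : delta != 0.
  by move: c0; rewrite -WE det_mxeval dW hornerC.
pose P' := P *m W.
(* This is [X^-1 Q]; it stays polynomial because [\det X] is the constant [delta]. *)
pose Q' := delta^-1%:P *: (\adj X *m Q).
have P'E : P' = c%:P *: P + c^*%:P *: pmxstar P.
  by rewrite /P' mulmxDr mul_mx_scalar -scalemxAr PU.
have XQ' z : mxeval X z *m mxeval Q' z = mxeval Q z.
  rewrite /Q' mxevalZ hornerC mxevalM -scalemxAr mulmxA -mxevalM mul_mx_adj.
  by rewrite mxeval_scalar dX hornerC mul_scalar_mx scalerA mulVf // scale1r.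
have starP' : pmxstar P' = P'.
  apply: mxeval_inj => m; rewrite mxeval_pmxstar P'E !mxevalD !mxevalZ !hornerC.
  by rewrite mxstarD !mxstarZ conjCK -!mxeval_pmxstar pmxstarK addrC.
have uP' z : `|z| <= 1 -> mxeval P' z \in unitmx.
  move=> z1; rewrite mxevalM unitmx_mul uP //= unitmx_mxeval dW hornerC.
  exact: delta0.
have uQ' z : `|z| <= 1 -> mxeval Q' z \in unitmx.
  by move=> z1; have := uQ z z1; rewrite -XQ' unitmx_mul => /andP[].
have fact z : z != 0 -> A z = mxeval P' z *m zdiag z *m mxeval Q' z^-1.
  by move=> z0; rewrite mxevalM -(mulmxA _ (mxeval W z)) WD // !mulmxA
    -(mulmxA _ (mxeval X _)) XQ' eA.
exists P', Q'; split=> //.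
(* Invariance of [Q'] follows by cancellation: applying star to the new factorization at the real
   point [1/w] leaves [A], [P'] and the diagonal fixed, and [P'] is invertible there since [1/w]
   lies in the unit disc. *)
apply: mxeval_inj => m; set w : C := m.+1%:R.
have w0 : w != 0 by rewrite pnatr_eq0.
have v0 : w^-1 != 0 by rewrite invr_eq0.
have v1 : `|w^-1| <= 1.
  by rewrite normfV normr_nat invf_le1 ?ltr0Sn // ler1n.
have wR : w^-1^* = w^-1 by rewrite fmorphV /= conjC_nat.
have starE P0 z : z^* = z -> mxstar (mxeval P0 z) = mxeval (pmxstar P0) z.
  by move=> zR; rewrite mxeval_pmxstar zR.
have D1 : mxstar (zdiag w^-1) = zdiag w^-1 by rewrite -{1}wR mxstar_zdiag.
have uPD : mxeval P' w^-1 *m zdiag w^-1 \in unitmx.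
  by rewrite unitmx_mul uP' ?zdiag_unit.
have := starA _ v0; rewrite wR fact // !mxstarM D1 invrK !starE ?conjC_nat ?wR //.
set E := _ *m zdiag _ in uPD *; rewrite starP' -/E => /(congr1 (mulmx (invmx E))).
by rewrite !mulKmx.
Qed.

End Symmetrization.

(** * Passage between [mlpoly] and polynomial matrices *)

Section LaurentPolynomials.
Variables (R : realType) (n : nat).
Local Notation C := R[i].
Implicit Types (A B : mlpoly R n) (P : 'M[{poly C}]_n).

Definition pos_part_mx A : 'M[{poly C}]_n :=
  \matrix_(i, j) \poly_(m < (mldeg A).+1) mlc A m%:Z i j.

Lemma mlrev_subproof A (r : int) : (mldeg A < `|r|)%N -> mlc A (- r) = 0.
Proof. by move=> Ar; rewrite mlc_supp // abszN. Qed.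

(** The substitution of [1/z] for [z], which lets the factor in [1/z] be handled as a polynomial
    matrix. *)
Definition mlrev A : mlpoly R n := MLPoly (@mlrev_subproof A).

Definition pmx_deg P : nat := \max_i \max_j size (P i j).

Lemma coef_pmx_deg P m : (pmx_deg P <= m)%N -> map_mx (fun p : {poly C} => p`_m) P = 0.
Proof.
move=> Pm; apply/matrixP => i j; rewrite !mxE nth_default //.
apply: leq_trans Pm; apply: leq_trans (leq_bigmax i).
exact: (leq_bigmax (F := fun j => size (P i j)) j).
Qed.

Definition pmx_coef P (r : int) : 'M[C]_n :=
  if r is Posz m then map_mx (fun p : {poly C} => p`_m) P else 0.

Lemma pmx_coef_supp P (r : int) : (pmx_deg P < `|r|)%N -> pmx_coef P r = 0.
Proof. by case: r => //= m /ltnW; apply: coef_pmx_deg. Qed.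

Definition mlpoly_of_pmx P : mlpoly R n := MLPoly (@pmx_coef_supp P).

Lemma meval_pos_part A z : in_polz A -> meval A z = mxeval (pos_part_mx A) z.
Proof.
move=> posA; rewrite /meval; set D := mldeg A.
rewrite -(big_mkord xpredT (fun m : nat =>
  z ^ (m%:Z - D%:Z) *: mlc A (m%:Z - D%:Z))).
(* Index [D] carries exponent 0; the terms before it have negative exponents and vanish. *)
rewrite (big_cat_nat (n := D)) //=; last by rewrite -addnn -addSn leq_addl.
rewrite big_nat_cond big1 ?add0r => [|m /andP[/andP[_ mD] _]]; last first.
  by rewrite posA ?scaler0 // subr_lt0 ltz_nat.
rewrite -{1}[D]add0n big_addn -addnn -addSn addnK big_mkord.
apply/matrixP => i j; rewrite mxevalE mxE horner_poly summxE.
by apply: eq_bigr => m _; rewrite PoszD addrK !mxE mulrC.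
Qed.

Lemma meval_inv_rev A w : meval_inv A w = mxeval (pos_part_mx (mlrev A)) w.
Proof.
apply/matrixP => i j; rewrite mxevalE mxE horner_poly summxE.
by apply: eq_bigr => m _; rewrite mxE mulrC.
Qed.

Lemma meval_rev A z : z != 0 -> meval (mlrev A) z^-1 = meval A z.
Proof.
move=> z0; rewrite /meval /=; set D := mldeg A.
have rev_exp m : (m <= D.*2)%N -> (D.*2.+1 - m.+1)%N%:Z - D%:Z = - (m%:Z - D%:Z).
  by move=> mD; rewrite subSS -subzn // -addnn PoszD opprB addrAC addrK.
rewrite (reindex_inj rev_ord_inj); apply: eq_bigr => m _ /=.
rewrite rev_exp; last by rewrite -ltnS.
by rewrite exprz_inv !opprK.
Qed.

Lemma pos_part_mxK P : pos_part_mx (mlpoly_of_pmx P) = P.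
Proof.
apply/matrixP => i j; apply/polyP => m; rewrite mxE coef_poly /= mxE.
case: ltnP => // /ltnW /coef_pmx_deg/matrixP/(_ i j).
by rewrite !mxE.
Qed.

(** Double reversal leaves [- - r] in the coefficient function, so the cancellation is stated on
    polynomial matrices rather than on records. *)
Lemma mlrevK_pos P : pos_part_mx (mlrev (mlrev (mlpoly_of_pmx P))) = P.
Proof.
rewrite -[RHS]pos_part_mxK; apply/matrixP => i j; rewrite !mxE.
by apply/polyP => m; rewrite !coef_poly /= opprK.
Qed.

Lemma in_polz_of_pmx P : in_polz (mlpoly_of_pmx P).
Proof. by case. Qed.

Lemma diag_pows_zdiag (s : seq int) (z : C) :
  diag_pows n s z = zdiag (fun i : 'I_n => nth 0 s i) z.
Proof.
by apply/matrixP => i j; rewrite !mxE; case: eqP => [->|]; rewrite ?mulr1n ?mulr0n.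
Qed.

Lemma eq_WH_factorization A Ap Am (D D' : C -> 'M[C]_n) :
  D =1 D' -> WH_factorization A Ap Am D -> WH_factorization A Ap Am D'.
Proof.
move=> eD [Ap1 Ap2 Am1 Am2 eA]; split; [exact: Ap1 | exact: Ap2 | exact: Am1 |
  exact: Am2 | by move=> z z0; rewrite -eD; exact: eA].
Qed.

Lemma star_invariant_WH (S : 'M[C]_n) (eps : C) (k : 'I_n -> int) A Ap Am :
  S *m S = 1%:M -> eps * eps = 1 -> map_mx Num.conj S = eps *: S ->
  (forall z, S *m zdiag k z = zdiag k z *m S) ->
  (forall r, mxstar S (mlc A r) = mlc A r) ->
  WH_factorization A Ap Am (zdiag k) ->
  exists Bp Bm : mlpoly R n,
    [/\ forall r, mxstar S (mlc Bp r) = mlc Bp r,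
        forall r, mxstar S (mlc Bm r) = mlc Bm r
      & WH_factorization A Bp Bm (zdiag k)].
Proof.
move=> S2 eps2 Sc SD starA [posAp uAp negAm uAm eA].
have negE B : in_polzinv B -> in_polz (mlrev B).
  by move=> hB r r0; rewrite /= hB // oppr_gt0.
have starev z : z != 0 -> mxstar S (meval A z^*) = meval A z.
  move=> z0; rewrite /meval /mxstar raddf_sum mulmx_sumr mulmx_suml.
  apply: eq_bigr => m _; rewrite -[RHS]/(_ *: _) -[in RHS]starA -[z in RHS]conjCK.
  by rewrite -[LHS]/(mxstar S _) mxstarZ fmorphXz.
have [z z1|w w1|z z0|P [Q [starP starQ uP uQ ePQ]]] :=
  star_invariant_factorization (P := pos_part_mx Ap)
    (Q := pos_part_mx (mlrev Am)) S2 eps2 Sc SD starev.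
- by rewrite -meval_pos_part ?uAp.
- by rewrite -meval_inv_rev uAm.
- rewrite eA // meval_pos_part // -(meval_rev Am) // meval_pos_part //.
  exact: negE.
have starC P0 r : pmxstar S P0 = P0 -> mxstar S (pmx_coef P0 r) = pmx_coef P0 r.
  case: r => [m|m] sP /=; first by rewrite -pmxstarE sP.
  by rewrite /mxstar raddf0 mulmx0 mul0mx.
exists (mlpoly_of_pmx P), (mlrev (mlpoly_of_pmx Q)); split.
- by move=> r; apply: starC.
- by move=> r; apply: starC.
split=> [|z z1| [[|m]|m] // |w w1|z z0].
- exact: in_polz_of_pmx.
- by rewrite meval_pos_part ?pos_part_mxK ?uP //; apply: in_polz_of_pmx.
- by rewrite meval_inv_rev mlrevK_pos uQ.
- have posQ : in_polz (mlrev (mlrev (mlpoly_of_pmx Q))).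
    by case=> // m _; rewrite /= opprK.
  rewrite (ePQ z z0) -(meval_rev (mlrev _) z0) (meval_pos_part _ posQ).
  by rewrite (meval_pos_part _ (@in_polz_of_pmx P)) mlrevK_pos pos_part_mxK.
Qed.

End LaurentPolynomials.

(** * Specialization to the real, complex and quaternionic cases *)

Lemma nth_flatten_nseq (s : seq int) (m a : nat) : (0 < m)%N ->
  nth 0 (flatten [seq nseq m x | x <- s]) a = nth 0 s (a %/ m).
Proof.
move=> m0; elim: s a => [|x s IH] a; first by rewrite !nth_nil.
rewrite /= nth_cat size_nseq; case: ltnP => am.
  by rewrite nth_nseq am divn_small.
by rewrite IH -{2}(subnK am) divnDr // divnn m0 addn1.
Qed.

Lemma Dsym_zdiag (R : realType) (F : numsys) (d : nat) (K : seq int) (z : R[i]) :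
  Dsym F d K z = zdiag (fun i : 'I_(cdim F d) => nth 0 K (i %/ numsys_mult F)) z.
Proof.
by apply/matrixP => i j; rewrite !mxE; case: eqP => [->|]; rewrite ?mulr1n ?mulr0n.
Qed.

Lemma sigma_y_sqr (R : realType) : sigma_y R *m sigma_y R = 1%:M.
Proof.
apply/matrixP => i j; rewrite !mxE !big_ord_recl big_ord0 !mxE /=.
by case: i => [[|[|[]]] ?] //; case: j => [[|[|[]]] ?] //=;
  rewrite ?(mulr0, mul0r, addr0, add0r, mulNr, mulrN) // -expr2 sqrCi ?opprK.
Qed.

Lemma sigma_y_conj (R : realType) : map_mx Num.conj (sigma_y R) = -1 *: sigma_y R.
Proof.
apply/matrixP => i j; rewrite !mxE mulN1r.
by do 2?case: ifP => _; rewrite ?rmorphN /= ?conjCi ?opprK ?rmorph0 ?oppr0.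
Qed.

Theorem theorem3p1 (R : realType) (F : numsys) (d : nat)
  (A : mlpoly R (cdim F d)) (K : seq int) :
  mlpoly_inF A ->
  (forall z : R[i], `|z| = 1 -> \det (meval A z) != 0) ->
  sym_partial_indices A K ->
  exists Ap Am : mlpoly R (cdim F d),
    [/\ mlpoly_inF Ap, mlpoly_inF Am
      & WH_factorization A Ap Am (Dsym F d K)].
Proof.
(* The complex factorization to be symmetrized is the one that defines the partial indices. *)
move=> AF _ [_ _ [_ _ [Ap [Am fact]]]].
pose k (i : 'I_(cdim F d)) := nth 0 K (i %/ numsys_mult F).
have {}fact : WH_factorization A Ap Am (zdiag k).
  apply: eq_WH_factorization fact => z; rewrite diag_pows_zdiag.
  apply/matrixP => i j; rewrite !mxE; congr (z ^ _ *+ _).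
  by rewrite /k nth_flatten_nseq //; case: (F).
suff [Bp [Bm [BpF BmF factB]]] : exists Bp Bm : mlpoly R (cdim F d),
    [/\ mlpoly_inF Bp, mlpoly_inF Bm & WH_factorization A Bp Bm (zdiag k)].
  exists Bp, Bm; split; [exact: BpF | exact: BmF |].
  by apply: eq_WH_factorization factB => z; rewrite Dsym_zdiag.
case: F A AF Ap Am @k fact => A AF Ap Am k fact.
- have starE (X : 'M[R[i]]_d) : mxstar 1%:M X = map_mx Num.conj X.
    by rewrite /mxstar mulmx1 mul1mx.
  have [||||r|Bp [Bm [sBp sBm factB]]] :=
    @star_invariant_WH R d 1%:M 1 k A Ap Am _ _ _ _ _ fact.
  + by rewrite mulmx1.
  + by rewrite mulr1.
  + by rewrite map_mx1 scale1r.
  + by move=> z; rewrite mulmx1 mul1mx.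
  + by rewrite starE; apply/matrixP => i j; rewrite mxE; apply: AF.
  exists Bp, Bm; split=> // r i j.
    by have /matrixP/(_ i j) := sBp r; rewrite starE mxE.
  by have /matrixP/(_ i j) := sBm r; rewrite starE mxE.
(* Over the complex numbers the given factorization already qualifies. *)
- by exists Ap, Am; split.
- have [||||r|Bp [Bm [sBp sBm factB]]] :=
    @star_invariant_WH R (d * 2) (1%:M *t sigma_y R) (-1) k A Ap Am _ _ _ _ _ fact.
  + rewrite tensmx_mul mulmx1 sigma_y_sqr; apply/matrixP => i j; rewrite !mxE.
    by rewrite -natrM mulnb -xpair_eqE -!surjective_pairing (can_eq (@mxtens_unindexK d 2)).
  + by rewrite mulrNN mulr1.
  + rewrite map_mxT map_mx1 sigma_y_conj.
    by apply/matrixP => i j; rewrite !mxE mulrCA.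
  (* A nonzero entry of [1 (x) sigma_y] joins only indices in the same 2 by 2 block, that is with
     equal quotient by 2, and [k] is constant on such a block. This is where the pairing of the
     indices enters. *)
  + move=> z; apply/matrixP => i j; rewrite mul_zdiag_mx mul_mx_zdiag mulrC.
    rewrite !mxE; case: eqP => [[ij]|_]; last by rewrite mul0r !mulr0.
    by rewrite /k /= ij.
  + exact: AF.
  by exists Bp, Bm; split.
Qed.
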